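(* Let $S$ be a strictly proper scoring rule. For every $\pi\in\Lambda$, the minimum Bayes risk of the prior disclosure game admits the decomposition $$r_S(\pi)=H_S(\pi)-I_S(\pi),\qquad I_S(\pi)=\mathbb{E}_{X\sim m^\pi}\big[D_S(\Pi_X^\pi\Vert\pi)\big]\ge 0.$$
   Context: Setting. $(\Omega,\mathcal{T})$ is a standard Borel parameter space; $\{P_\theta:\theta\in\Omega\}$ is a family of probability measures on a measurable space $(\mathcal{X},\mathcal{A})$ dominated by a $\sigma$-finite measure $\lambda$, with densities $p_\theta=dP_\theta/d\lambda$. $\Lambda$ is a set of probability measures on $(\Omega,\mathcal{T})$ (priors), with the weak topology and its Borel $\sigma$-algebra. For a prior $\pi$, the prior predictive $m^\pi$ is the measure on $\mathcal{X}$ with $\frac{dm^\pi}{d\lambda}(x)=\int_\Omega p_\theta(x)\,d\pi(\theta)$, and $\Pi_x^\pi$ is the Bayes posterior on $\Omega$ given $X=x$, assumed to exist for $m^\pi$-almost all $x$ and to be measurable in $x$. Scores. A scoring rule $S$ assigns to each probability measure $Q$ on $(\Omega,\mathcal{T})$ a measurable function $S(Q,\cdot):\Omega\to\mathbb{R}\cup\{-\infty\}$. It is proper if $\mathbb{E}_{Y\sim P}[S(P,Y)]\ge\mathbb{E}_{Y\sim P}[S(Q,Y)]$ for all $P,Q$, and strictly proper if in addition equality implies $Q=P$. Its generalized entropy is $H_S(P)=-\mathbb{E}_{Y\sim P}[S(P,Y)]$ and its score divergence is $D_S(P\Vert Q)=\mathbb{E}_{Y\sim P}[S(P,Y)-S(Q,Y)]$.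 Prior disclosure game. A decision rule is a measurable map $\delta:\mathcal{X}\to\Lambda$. The loss is $\ell_S(\theta,x,a)=-S(\Pi_x^a,\theta)$ for $a\in\Lambda$. The frequentist risk is $\mathcal{R}_S(\delta,\theta)=\mathbb{E}_{X\sim P_\theta}[\ell_S(\theta,X,\delta(X))]$. The Bayes risk under $\pi\in\Lambda$ is $$R_S(\delta,\pi)=\mathbb{E}_{\Theta\sim\pi}[\mathcal{R}_S(\delta,\Theta)]=-\mathbb{E}_{X\sim m^\pi}\Big[\mathbb{E}_{\Theta\sim\Pi_X^\pi}\big[S(\Pi_X^{\delta(X)},\Theta)\big]\Big],$$ and the minimum Bayes risk is $r_S(\pi)=\inf_\delta R_S(\delta,\pi)$ over all decision rules. Conventions. The posteriors $\Pi_x^a$ appearing in these definitions are assumed to exist; the risks, entropies, divergences and the expectations defining them are measurable, well defined and finite. *)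

(* Defs.v *)
From HB Require Import structures.
From mathcomp Require Import all_boot all_order all_algebra.
From mathcomp Require Import all_classical all_reals all_analysis.
From mathcomp Require Import measurable_realfun giry.

Set Implicit Arguments.
Unset Strict Implicit.
Unset Printing Implicit Defensive.

Import Order.TTheory GRing.Theory Num.Theory.
Import numFieldNormedType.Exports.

Local Open Scope classical_set_scope.
Local Open Scope ring_scope.

(* A standard Borel space is the Borel space of a Polish space; the topology is
   kept as part of the data because the weak topology on priors uses it. *)
Definition polish (R : realType) (T : topologicalType) : Prop :=
  @second_countable T /\
  exists (M : metricType R) (f : T -> M) (g : M -> T),
    [/\ forall F : set_system M, ProperFilter F -> cauchy F ->
          exists x : M, F --> x,
        cancel f g, cancel g f, continuous f & continuous g].

Definition borel (T : ptopologicalType) := g_sigma_algebraType (@open T).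

Definition prior (R : realType) (Om : ptopologicalType) :=
  probability (borel Om) R.

Section weak_topology_on_priors.
Context (R : realType) (Om : ptopologicalType).

Definition bounded_continuous :=
  {f : Om -> R | continuous f /\ bounded_fun f}.

Definition weak_ev (P : prior R Om) (f : bounded_continuous) : R :=
  \int[P]_t sval f t.

(* the coarsest topology making every P |-> \int f dP, f bounded continuous,
   continuous *)
Definition weak_prior : ptopologicalType :=
  initial_topology (weak_ev : prior R Om -> prod_topology (fun=> R)).

Definition borel_prior := borel weak_prior.

End weak_topology_on_priors.

Local Open Scope ereal_scope.

Section dominated_model.
Context (R : realType) (Om : ptopologicalType)
  (d : measure_display) (X : measurableType d).

Record dominated_model (lambda : {sigma_finite_measure set X -> \bar R}) :=
  DominatedModel {
    law : borel Om -> probability X R ;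
    dens : borel Om -> X -> R ;
    dens_ge0 : forall t x, (0 <= dens t x)%R ;
    measurable_dens :
      measurable_fun [set: borel Om * X] (fun z => dens z.1 z.2) ;
    law_dens : forall t A, measurable A ->
      law t A = \int[lambda]_(x in A) (dens t x)%:E }.

Context (lambda : {sigma_finite_measure set X -> \bar R})
  (M : dominated_model lambda).

Definition marginal (pi : prior R Om) (x : X) : \bar R :=
  \int[pi]_t (dens M t x)%:E.

Lemma marginal_ge0 pi x : 0 <= marginal pi x.
Proof. by apply: integral_ge0 => t _; rewrite lee_fin dens_ge0. Qed.

Lemma measurable_marginal pi : measurable_fun setT (marginal pi).
Proof.
pose f := fun z : borel Om * X => (dens M z.1 z.2)%:E.
have mf : measurable_fun setT f.
  by apply/measurable_EFinP; exact: measurable_dens.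
have f0 z : 0 <= f z by rewrite lee_fin dens_ge0.
exact: (measurable_fun_fubini_tonelli_G (m1 := pi) f mf f0).
Qed.

Definition prior_predictive (pi : prior R Om) (A : set X) : \bar R :=
  \int[lambda]_(x in A) marginal pi x.

Section prior_predictive_measure.
Variable pi : prior R Om.

Let prior_predictive0 : prior_predictive pi set0 = 0.
Proof. exact: integral_set0. Qed.

Let prior_predictive_ge0 A : 0 <= prior_predictive pi A.
Proof. by apply: integral_ge0 => x _; exact: marginal_ge0. Qed.

Let prior_predictive_sigma_additive :
  semi_sigma_additive (prior_predictive pi).
Proof.
move=> F mF tF mUF; rewrite /prior_predictive ge0_integral_bigcup//.
- apply: is_cvg_ereal_nneg_natsum_cond => n _ _.
  by apply: integral_ge0 => x _; exact: marginal_ge0.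
- exact/measurable_funTS/measurable_marginal.
- by move=> x _; exact: marginal_ge0.
Qed.

HB.instance Definition _ := isMeasure.Build _ _ _ (prior_predictive pi)
  prior_predictive0 prior_predictive_ge0 prior_predictive_sigma_additive.

End prior_predictive_measure.

(* k is a version of the posterior x |-> Pi_x^a: Bayes' formula is imposed only
   for prior-predictive almost every x, which also makes the values of the
   quotient at marginal a x = 0 or +oo irrelevant. *)
Definition bayes_posterior (a : prior R Om) (k : X -> prior R Om) : Prop :=
  (forall B : set (borel Om), measurable B ->
     measurable_fun [set: X] (fun x => k x B)) /\
  {ae prior_predictive a, forall x, forall B : set (borel Om), measurable B ->
     k x B = (\int[a]_(t in B) (dens M t x)%:E) / marginal a x}.

End dominated_model.

Section scores.
Context (R : realType) (Om : ptopologicalType).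
Implicit Types (S : prior R Om -> borel Om -> \bar R) (P Q : prior R Om).

Definition scoring_rule S : Prop :=
  forall Q, measurable_fun setT (S Q) /\ forall t, S Q t != +oo.

Definition expected_score S Q P : \bar R := \int[P]_y S Q y.

Definition proper S : Prop :=
  forall P Q, expected_score S Q P <= expected_score S P P.

(* Q = P is equality of measures, i.e. on measurable sets: Leibniz equality in
   [probability] would also compare values on nonmeasurable sets. *)
Definition strictly_proper S : Prop :=
  proper S /\
  forall P Q, expected_score S P P = expected_score S Q P -> measure_eq Q P.

Definition entropy S P : \bar R := - expected_score S P P.

Definition divergence S P Q : \bar R := \int[P]_y (S P y - S Q y).

End scores.

Section prior_disclosure_game.
Context (R : realType) (Om : ptopologicalType)
  (d : measure_display) (X : measurableType d)
  (lambda : {sigma_finite_measure set X -> \bar R})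
  (M : dominated_model Om lambda) (Lam : set (prior R Om))
  (post : prior R Om -> X -> prior R Om)
  (S : prior R Om -> borel Om -> \bar R).
Implicit Types (delta : X -> prior R Om) (pi : prior R Om).

(* The Borel sets of the subspace Lam are the traces on Lam of the Borel sets
   of the whole space of priors. *)
Definition decision_rule delta : Prop :=
  (forall x, Lam (delta x)) /\
  measurable_fun [set: X] (delta : X -> borel_prior R Om).

Definition loss (t : borel Om) (x : X) (a : prior R Om) : \bar R :=
  - S (post a x) t.

Definition freq_risk delta (t : borel Om) : \bar R :=
  \int[law M t]_x loss t x (delta x).

Definition bayes_risk delta pi : \bar R := \int[pi]_t freq_risk delta t.

Definition min_bayes_risk pi : \bar R :=
  ereal_inf [set bayes_risk delta pi | delta in decision_rule].

(* the loss is measurable in (theta, x) and integrable under the joint law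
   pi(dtheta) P_theta(dx) *)
Definition finite_risk delta pi : Prop :=
  measurable_fun [set: borel Om * X]
    (fun z => loss z.1 z.2 (delta z.2)) /\
  \int[pi]_t \int[law M t]_x `|loss t x (delta x)| < +oo.

Definition information pi : \bar R :=
  \int[prior_predictive M pi]_x divergence S (post pi x) pi.

End prior_disclosure_game.

(* Main.v *)
Require Import Defs.
From HB Require Import structures.
From mathcomp Require Import all_boot all_order all_algebra.
From mathcomp Require Import all_classical all_reals all_analysis.
From mathcomp Require Import measurable_realfun giry.

Set Implicit Arguments.
Unset Strict Implicit.
Unset Printing Implicit Defensive.

Import Order.TTheory GRing.Theory Num.Theory.
Import numFieldNormedType.Exports.

Local Open Scope classical_set_scope.
Local Open Scope ring_scope.
Local Open Scope ereal_scope.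

(** The prior and the sampling model define a joint law of parameter and
    observation, and Bayes' formula says that this law disintegrates in two ways:

      pi(dt) P_t(dx) = m(dx) k_x(dt),

    where m is the prior predictive and k a version of the posterior
    ([ge0_bayes_disintegration], [bayes_disintegration]).

    A decision rule delta matters only through the forecast x |-> q x of the
    parameter that it produces, namely q x = Pi_x^(delta x).  Reading the risk
    of an arbitrary forecast q in the second disintegration and comparing it with
    the risk of the forecast k, the scores combine under the posterior into

      risk q - risk k = E_m [D_S(k_x || q_x)]  ([excess_riskE]),

    which is nonnegative because S is proper ([excess_risk_ge0]).  This single
    identity gives everything, by two choices of q.

    - For q x = Pi_x^(delta x), it says that no rule has a smaller Bayes risk than
      the forecast Pi_x^pi, which is the one produced by the constant rule pi;
      the infimum is therefore attained at that rule.
    - For q x = pi, the forecast that ignores the observation, the risk of q is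
      the entropy of pi, and the right-hand side is the information.  Hence the
      minimum Bayes risk is the entropy minus the information, and the
      information is nonnegative.

    Scores may take the value -oo and are integrable only jointly, so
    divergences can be split into differences of integrals, and their sign
    read off, only for almost every x. *)

(** * Integration against a density *)

Section density.
Context d (T : measurableType d) (R : realType).
Variables (mu nu : {measure set T -> \bar R}) (g : T -> R).
Hypotheses (g0 : forall x, (0 <= g x)%R) (mg : measurable_fun setT g).
Hypothesis muE : forall A, measurable A -> mu A = \int[nu]_(x in A) (g x)%:E.

Import HBNNSimple.

Let nnsfun_integral_density (h : {nnsfun T >-> R}) :
  \int[mu]_x (h x)%:E = \int[nu]_x ((h x)%:E * (g x)%:E).
Proof.
have mgE : measurable_fun setT (EFin \o g) by exact/measurable_EFinP.
have gE0 x : 0 <= (EFin \o g) x by rewrite lee_fin.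
rewrite integralT_nnsfun sintegralE.
transitivity (\int[nu]_x (\sum_(r \in range h)
    (r * \1_(h @^-1` [set r]) x)%:E * (g x)%:E)); last first.
  apply: eq_integral => x _; rewrite -ge0_mule_fsuml => [|r].
    by rewrite fsumEFin// -fimfunE.
  by rewrite EFinM nnfun_muleindic_ge0.
rewrite ge0_integral_fsum//; last 2 first.
  - by move=> r; apply: emeasurable_funM => //;
    exact/measurable_EFinP/measurable_funM.
  - by move=> r x _; rewrite mule_ge0 ?lee_fin// -lee_fin EFinM
      nnfun_muleindic_ge0.
apply: eq_fsbigr => r; rewrite inE => -[t _ <-].
rewrite muE// integral_mkcond -ge0_integralZl//; last 3 first.
- have mh : measurable (h @^-1` [set h t]) by [].
  have mgh := measurable_funTS mgE : measurable_fun (h @^-1` [set h t]) _.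
  exact: (iffLR (measurable_restrictT (EFin \o g) mh) mgh).
- by move=> x _; rewrite patchE; case: ifP => // _; exact: gE0.
- by rewrite lee_fin.
apply: eq_integral => x _; rewrite EFinM -muleA; congr (_ * _).
by rewrite patchE indicE; case: ifP; rewrite ?mul1e ?mul0e.
Qed.

(** Monotone convergence reduces the claim to simple functions.  The density is
    real-valued so that the products with the approximants converge. *)
Lemma ge0_integral_density (f : T -> \bar R) : (forall x, 0 <= f x) ->
  measurable_fun setT f -> \int[mu]_x f x = \int[nu]_x (f x * (g x)%:E).
Proof.
move=> f0 mf; pose h := nnsfun_approx measurableT mf.
have fE x : (EFin \o h n) x @[n --> \oo] --> f x by exact: cvg_nnsfun_approx.
transitivity (\int[mu]_x lim ((EFin \o h n) x @[n --> \oo])).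
  by apply: eq_integral => x _; apply/esym/cvg_lim.
rewrite monotone_convergence//; last 3 first.
- by move=> n; exact/measurable_EFinP.
- by move=> n x _; rewrite lee_fin.
- by move=> x _ a b ab; rewrite lee_fin; exact/lefP/nd_nnsfun_approx.
transitivity (\int[nu]_x lim ((h n x)%:E * (g x)%:E @[n --> \oo])); last first.
  apply: eq_integral => x _; apply/cvg_lim => //.
  by apply: cvgeZr => //; exact: fE.
rewrite monotone_convergence//; last 3 first.
- by move=> n; apply: emeasurable_funM; exact/measurable_EFinP.
- by move=> n x _; rewrite mule_ge0// lee_fin.
- move=> x _ a b ab; rewrite lee_wpmul2r ?lee_fin//.
  exact/lefP/nd_nnsfun_approx.
by congr (lim (_ @ \oo)); apply/funext => n; exact: nnsfun_integral_density.
Qed.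

End density.

(** * Iterated integrals against a probability kernel *)

Section iterated_integral.
Context d d' (Y : measurableType d) (Z : measurableType d') (R : realType).
Variable k : Y -> probability Z R.
Hypothesis mk : forall B, measurable B -> measurable_fun setT (fun y => k y B).

(* A separate constant, so that the kernel structure can be attached to it. *)
Let kernel (y : Y) : {measure set Z -> \bar R} := k y.

HB.instance Definition _ := isKernel.Build _ _ Y Z R kernel mk.

Let kernel_setT y : kernel y setT = 1. Proof. exact: probability_setT. Qed.

HB.instance Definition _ := Kernel_isProbability.Build _ _ Y Z R kernel
  kernel_setT.

Lemma ge0_measurable_integral_prob (f : Y * Z -> \bar R) :
  (forall z, 0 <= f z) -> measurable_fun setT f ->
  measurable_fun setT (fun y => \int[k y]_z f (y, z)).
Proof.
by move=> f0 mf; exact: (measurable_fun_integral_finite_kernel f kernel).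
Qed.

(* The positive part of a section of f is the section of the positive part of
   f, which is measurable on the product. *)
Let integral_sectionE (f : Y * Z -> \bar R) y : \int[k y]_z f (y, z) =
  \int[k y]_z f^\+ (y, z) - \int[k y]_z f^\- (y, z).
Proof.
rewrite integralE; congr (_ - _).
- by apply: eq_integral => z _; rewrite !funeposE.
- by apply: eq_integral => z _; rewrite !funenegE.
Qed.

Lemma measurable_integral_prob (f : Y * Z -> \bar R) : measurable_fun setT f ->
  measurable_fun setT (fun y => \int[k y]_z f (y, z)).
Proof.
move=> mf; under eq_fun do rewrite integral_sectionE.
apply: emeasurable_funB.
- apply: (@ge0_measurable_integral_prob f^\+) => //; exact: measurable_funepos.
- apply: (@ge0_measurable_integral_prob f^\-) => //; exact: measurable_funeneg.
Qed.

Variables (nu : {measure set Y -> \bar R}) (f : Y * Z -> \bar R).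
Hypotheses (mf : measurable_fun setT f)
  (foo : \int[nu]_y \int[k y]_z `|f (y, z)| < +oo).

Let mabs : measurable_fun setT (fun y => \int[k y]_z `|f (y, z)|).
Proof.
apply: (@ge0_measurable_integral_prob (abse \o f)) => [z|].
  exact: abse_ge0.
exact: measurableT_comp.
Qed.

(** A function with a finite integral is finite almost everywhere; here the
    function is y |-> \int[k y]_z `|f (y, z)|. *)
Lemma ae_integrable_prob : {ae nu, forall y,
  (k y : {measure set Z -> \bar R}).-integrable setT (fun z => f (y, z))}.
Proof.
have /integrable_ae : nu.-integrable setT (fun y => \int[k y]_z `|f (y, z)|).
  apply/integrableP; split => //.
  by under eq_integral do rewrite gee0_abs ?integral_ge0//.
move=> /(_ measurableT); apply: filterS => y /(_ I) yfin.
apply/integrableP; split; first exact: measurableT_comp.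
by rewrite ltey_eq yfin.
Qed.

Lemma integrable_iterated : nu.-integrable setT (fun y => \int[k y]_z f (y, z)).
Proof.
apply/integrableP; split; first exact: measurable_integral_prob.
apply: le_lt_trans foo; apply: ge0_le_integral => //.
- by apply: measurableT_comp => //; exact: measurable_integral_prob.
- by move=> y _; apply: le_abse_integral => //; exact: measurableT_comp.
Qed.

(** Carries identities between iterated integrals of nonnegative functions over
    to signed ones; joint integrability rules out a difference of infinities. *)
Lemma iterated_integralE : \int[nu]_y \int[k y]_z f (y, z) =
  \int[nu]_y \int[k y]_z f^\+ (y, z) - \int[nu]_y \int[k y]_z f^\- (y, z).
Proof.
have int_part (h : Y * Z -> \bar R) : (forall z, 0 <= h z) ->
    measurable_fun setT h -> (forall z, h z <= `|f z|) ->
    nu.-integrable setT (fun y => \int[k y]_z h (y, z)).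
  move=> h0 mh hf.
  apply/integrableP; split; first exact: measurable_integral_prob.
  apply: le_lt_trans foo; apply: ge0_le_integral => //.
  - by apply: measurableT_comp => //; exact: measurable_integral_prob.
  - move=> y _; rewrite gee0_abs ?integral_ge0//.
    apply: ge0_le_integral => //; first exact: measurableT_comp.
    by apply: measurableT_comp => //; exact: measurableT_comp.
under eq_integral do rewrite integral_sectionE.
rewrite integralB//.
- apply: (int_part f^\+) => //; first exact: measurable_funepos.
  by move=> z; rewrite -/((abse \o f) z) fune_abse leeDl.
- apply: (int_part f^\-) => //; first exact: measurable_funeneg.
  by move=> z; rewrite -/((abse \o f) z) fune_abse leeDr.
Qed.

End iterated_integral.

(** * Bayes' formula as a disintegration of the joint law *)

Section bayes.
Context (R : realType) (Om : ptopologicalType)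
  (d : measure_display) (X : measurableType d)
  (lambda : {sigma_finite_measure set X -> \bar R})
  (M : dominated_model Om lambda).

Let mdens : measurable_fun [set: borel Om * X] (fun z => (dens M z.1 z.2)%:E).
Proof. by apply/measurable_EFinP; exact: measurable_dens. Qed.

Let densE0 t x : 0 <= (dens M t x)%:E.
Proof. by rewrite lee_fin dens_ge0. Qed.

Let measurable_dens1 t : measurable_fun setT (dens M t).
Proof. exact: (measurableT_comp (measurable_dens M) (pair1_measurable t)). Qed.

Let measurable_dens2 x : measurable_fun setT (fun t => dens M t x).
Proof. exact: (measurableT_comp (measurable_dens M) (pair2_measurable x)). Qed.

Lemma measurable_law A : measurable A ->
  measurable_fun setT (fun t => law M t A).
Proof.
move=> mA.
pose f (z : borel Om * X) := (dens M z.1 z.2)%:E * (\1_A z.2)%:E.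
have mf : measurable_fun setT f.
  apply: emeasurable_funM => //; apply/measurable_EFinP.
  exact: measurableT_comp.
have f0 z : 0 <= f z by rewrite mule_ge0// lee_fin.
rewrite (_ : (fun t => _) = fubini_F lambda f).
  exact: measurable_fun_fubini_tonelli_F.
apply/funext => t; rewrite law_dens// /fubini_F [LHS]integral_mkcond.
apply: eq_integral => x _; rewrite patchE /f /= indicE.
by case: ifP; rewrite ?mule1 ?mule0.
Qed.

Lemma ge0_integral_law t (f : X -> \bar R) : (forall x, 0 <= f x) ->
  measurable_fun setT f ->
  \int[law M t]_x f x = \int[lambda]_x (f x * (dens M t x)%:E).
Proof.
by apply: ge0_integral_density => // [x|A mA]; [exact: dens_ge0|exact: law_dens].
Qed.

Variable pi : prior R Om.

(** By Tonelli, the marginal density has total integral 1. *)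
Lemma ae_marginal_fin : {ae lambda, forall x, marginal M pi x \is a fin_num}.
Proof.
suff /integrable_ae : lambda.-integrable setT (marginal M pi).
  by move=> /(_ measurableT); apply: filterS => x; exact.
apply/integrableP; split; first exact: measurable_marginal.
under eq_integral do rewrite gee0_abs ?marginal_ge0//.
rewrite /marginal -(@fubini_tonelli _ _ _ _ _ pi lambda
  (fun z => (dens M z.1 z.2)%:E))//=.
rewrite (eq_integral (cst 1)) => [|t _]; last first.
  by rewrite -law_dens//; exact: probability_setT.
rewrite integral_cst// mul1e; apply: (@le_lt_trans _ _ 1); last exact: ltry.
by rewrite le_eqVlt; apply/orP; left; apply/eqP; exact: probability_setT.
Qed.

Let fine_marginal_ge0 x : (0 <= fine (marginal M pi x))%R.
Proof. exact/fine_ge0/marginal_ge0. Qed.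

Let measurable_fine_marginal : measurable_fun setT (fine \o marginal M pi).
Proof. by apply: measurableT_comp => //; exact: measurable_marginal. Qed.

Lemma ge0_integral_prior_predictive (f : X -> \bar R) :
  (forall x, 0 <= f x) -> measurable_fun setT f ->
  \int[prior_predictive M pi]_x f x =
  \int[lambda]_x (f x * (fine (marginal M pi x))%:E).
Proof.
apply: (@ge0_integral_density _ _ _ _ _ (fine \o marginal M pi)) => // A mA.
apply: ge0_ae_eq_integral => //.
- exact/measurable_funTS/measurable_marginal.
- by apply/measurable_EFinP; exact: measurable_funTS.
- by move=> x _; exact: marginal_ge0.
- by move=> x _; rewrite lee_fin; exact: fine_marginal_ge0.
- by apply: filterS ae_marginal_fin => x mfin _; rewrite /= fineK.
Qed.

(** This is where Bayes' formula, stated up to prior-predictive null sets, is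
    turned into a lambda-almost everywhere identity between functions.
    Where the marginal density is finite, either it is positive and Bayes'
    formula gives the identity, or it vanishes and then the likelihood vanishes
    almost everywhere under the prior. *)
Lemma bayes_density (k : X -> prior R Om) (bk : bayes_posterior M pi k) :
  {ae lambda, forall x, forall f : borel Om -> \bar R, (forall t, 0 <= f t) ->
    measurable_fun setT f ->
    \int[pi]_t (f t * (dens M t x)%:E) =
    (\int[k x]_t f t) * (fine (marginal M pi x))%:E}.
Proof.
have [mk [N [mN N0 subN]]] := bk.
(* The exceptional set of Bayes' formula is null for the prior predictive, not
   for lambda; on it the marginal density vanishes lambda-almost everywhere. *)
have marginalN : {ae lambda, forall x, N x -> marginal M pi x = 0}.
  apply/(ae_eq_integral_abs lambda mN
    (measurable_funTS (measurable_marginal M pi))).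
  by under eq_integral do rewrite gee0_abs ?marginal_ge0//.
near=> x => f f0 mf.
have mfin : marginal M pi x \is a fin_num.
  by near: x; exact: ae_marginal_fin.
have mgfE t : 0 <= f t * (dens M t x)%:E by rewrite mule_ge0.
have [m0|m0] := eqVneq (marginal M pi x) 0.
  rewrite m0 mule0.
  have dens0 : {ae pi, forall t, setT t -> (dens M t x)%:E = 0}.
    apply/(ae_eq_integral_abs pi measurableT) => //.
      by apply/measurable_EFinP.
    by under eq_integral do rewrite gee0_abs//.
  rewrite (ge0_ae_eq_integral (g := cst 0))// ?integral0//.
  - by apply: emeasurable_funM => //; apply/measurable_EFinP.
  - by apply: filterS dens0 => t /(_ I) ->; rewrite mule0.
have kE B : measurable B ->
    k x B = (\int[pi]_(t in B) (dens M t x)%:E) / marginal M pi x.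
  move: B; apply: contrapT => nk; move/eqP: m0; apply.
  suff : N x -> marginal M pi x = 0 by apply; exact: subN.
  by near: x.
have mgt0 : (0 < fine (marginal M pi x))%R.
  by rewrite lt0r fine_eq0// m0 fine_marginal_ge0.
rewrite (@ge0_integral_density _ _ _ (k x) pi
    (fun t => dens M t x / fine (marginal M pi x))%R)//.
- rewrite muleC -ge0_integralZl//; last 3 first.
  + apply: emeasurable_funM => //; apply/measurable_EFinP.
    exact: measurable_funM.
  + by move=> t _; rewrite mule_ge0// lee_fin divr_ge0// dens_ge0.
  + by rewrite lee_fin.
  apply: eq_integral => t _; rewrite muleCA -EFinM.
  by rewrite mulrCA divff ?mulr1// gt_eqF.
- by move=> t; rewrite divr_ge0// dens_ge0.
- exact: measurable_funM.
- move=> A mA; apply: (etrans (kE A mA)).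
  rewrite -[X in _ / X]fineK// inver gt_eqF//.
  rewrite muleC -ge0_integralZl//; last 2 first.
  + by apply/measurable_EFinP; exact: measurable_funTS.
  + by rewrite lee_fin invr_ge0.
  by apply: eq_integral => t _; rewrite muleC.
Unshelve. all: by end_near. Qed.

(** Both sides are the integral of f times the likelihood against pi and
    lambda: the left one by definition of the model, the right one by
    [bayes_density], with the order of integration exchanged by Tonelli. *)
Lemma ge0_bayes_disintegration (k : X -> prior R Om)
    (f : borel Om * X -> \bar R) :
  bayes_posterior M pi k -> (forall z, 0 <= f z) -> measurable_fun setT f ->
  \int[pi]_t \int[law M t]_x f (t, x) =
  \int[prior_predictive M pi]_x \int[k x]_t f (t, x).
Proof.
move=> bk f0 mf.
have mkf : measurable_fun setT (fun x => \int[k x]_t f (t, x)).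
  apply: (ge0_measurable_integral_prob bk.1 (f := fun z => f (z.2, z.1))) => //.
  by apply: measurableT_comp => //; exact: measurable_swap.
under eq_integral => t _.
  rewrite ge0_integral_law//; last exact: measurableT_comp.
  over.
rewrite (@fubini_tonelli _ _ _ _ _ pi lambda
  (fun z => f z * (dens M z.1 z.2)%:E)); last 2 first.
- exact: emeasurable_funM.
- by move=> z; rewrite mule_ge0.
rewrite ge0_integral_prior_predictive//; last first.
  by move=> x; exact: integral_ge0.
apply: ge0_ae_eq_integral => //.
- apply: (@measurable_fun_fubini_tonelli_G _ _ _ _ _ pi
    (fun z => f z * (dens M z.1 z.2)%:E)) => [|z].
    exact: emeasurable_funM.
  by rewrite mule_ge0.
- by apply: emeasurable_funM => //; exact/measurable_EFinP.
- by move=> x _; apply: integral_ge0 => t _; rewrite mule_ge0.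
- by move=> x _; rewrite mule_ge0 ?integral_ge0// lee_fin.
apply: filterS (bayes_density bk) => x + _ => -> //.
exact: measurableT_comp.
Qed.

End bayes.

(** * Excess risk of a forecast over the posterior *)

Lemma divergence_ge0 (R : realType) (Om : ptopologicalType)
    (S : prior R Om -> borel Om -> \bar R) (P Q : prior R Om) : Defs.proper S ->
  (P : {measure set (borel Om) -> \bar R}).-integrable setT (S P) ->
  (P : {measure set (borel Om) -> \bar R}).-integrable setT (S Q) ->
  0 <= divergence S P Q.
Proof.
move=> propS iP iQ; rewrite /divergence integralB//.
by rewrite sube_ge0 ?integrable_fin_num//; exact: propS.
Qed.

Section excess_risk.
Context (R : realType) (Om : ptopologicalType)
  (d : measure_display) (X : measurableType d)
  (lambda : {sigma_finite_measure set X -> \bar R})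
  (M : dominated_model Om lambda) (pi : prior R Om)
  (k : X -> prior R Om) (bk : bayes_posterior M pi k).

Section bayes_disintegration.
Variable f : borel Om * X -> \bar R.
Hypotheses (mf : measurable_fun setT f)
  (foo : \int[pi]_t \int[law M t]_x `|f (t, x)| < +oo).

Lemma posterior_integral_lty :
  \int[prior_predictive M pi]_x \int[k x]_t `|f (t, x)| < +oo.
Proof.
rewrite -(ge0_bayes_disintegration bk (f := abse \o f))//.
- by move=> z; exact: abse_ge0.
- exact: measurableT_comp.
Qed.

Lemma bayes_disintegration : \int[pi]_t \int[law M t]_x f (t, x) =
  \int[prior_predictive M pi]_x \int[k x]_t f (t, x).
Proof.
rewrite (iterated_integralE (measurable_law M))//.
rewrite (iterated_integralE bk.1 (f := fun z => f (z.2, z.1))); last 2 first.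
- by apply: measurableT_comp => //; exact: measurable_swap.
- exact: posterior_integral_lty.
congr (_ - _).
- rewrite (ge0_bayes_disintegration bk)//; last exact: measurable_funepos.
  by apply: eq_integral => x _; apply: eq_integral => t _; rewrite !funeposE.
- rewrite (ge0_bayes_disintegration bk)//; last exact: measurable_funeneg.
  by apply: eq_integral => x _; apply: eq_integral => t _; rewrite !funenegE.
Qed.

End bayes_disintegration.

Variables (S : prior R Om -> borel Om -> \bar R).

Definition forecast_risk (q : X -> prior R Om) : \bar R :=
  \int[pi]_t \int[law M t]_x - S (q x) t.

(** The same condition as [finite_risk], for a forecast that need not be the
    posterior of some prior: it is also used for the constant forecast pi. *)
Definition finite_forecast (q : X -> prior R Om) : Prop :=
  measurable_fun [set: borel Om * X] (fun z => - S (q z.2) z.1) /\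
  \int[pi]_t \int[law M t]_x `|- S (q x) t| < +oo.

Lemma forecast_risk_fin q : finite_forecast q -> forecast_risk q \is a fin_num.
Proof.
move=> [mq qoo]; apply: integrable_fin_num => //.
exact: (integrable_iterated (measurable_law M) mq qoo).
Qed.

Lemma ae_integrable_score q : finite_forecast q ->
  {ae prior_predictive M pi, forall x,
    (k x : {measure set (borel Om) -> \bar R}).-integrable setT (S (q x))}.
Proof.
move=> [mq qoo].
have : {ae prior_predictive M pi, forall x,
    (k x : {measure set (borel Om) -> \bar R}).-integrable setT
      (fun t => - S (q x) t)}.
  apply: (ae_integrable_prob bk.1 (f := fun z => - S (q z.1) z.2)).
    exact: (measurableT_comp mq (@measurable_swap _ _ _ _)).
  exact: (posterior_integral_lty mq).
apply: filterS => x /integrableN; apply: eq_integrable => // t _ /=.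
by rewrite oppeK.
Qed.

Variable q : X -> prior R Om.
Hypotheses (fink : finite_forecast k) (finq : finite_forecast q).

(* Kernels out of X need the observation as first coordinate. *)
Let swapped (h : X -> prior R Om) (z : X * borel Om) := - S (h z.1) z.2.

Let measurable_swapped h : finite_forecast h -> measurable_fun setT (swapped h).
Proof.
by move=> [mh _]; exact: (measurableT_comp mh (@measurable_swap _ _ _ _)).
Qed.

Let divergence_swapped x :
  divergence S (k x) (q x) = \int[k x]_t (swapped q (x, t) - swapped k (x, t)).
Proof. by apply: eq_integral => t _; rewrite /swapped/= oppeK addeC. Qed.

Let integrable_swapped h : finite_forecast h ->
  (prior_predictive M pi).-integrable setT
    (fun x => \int[k x]_t swapped h (x, t)).
Proof.
move=> fh; apply: (integrable_iterated bk.1 (measurable_swapped fh)).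
exact: (posterior_integral_lty fh.1 fh.2).
Qed.

Let measurable_divergence :
  measurable_fun setT (fun x => divergence S (k x) (q x)).
Proof.
under eq_fun do rewrite divergence_swapped.
apply: (measurable_integral_prob bk.1 (f := swapped q \- swapped k)).
by apply: emeasurable_funB; exact: measurable_swapped.
Qed.

(** For almost every x both scores are integrable under k x, so the divergence is
    the difference of the two expected scores; integrating over x recovers the
    two risks. *)
Lemma excess_riskE :
  \int[prior_predictive M pi]_x divergence S (k x) (q x) =
  forecast_risk q - forecast_risk k.
Proof.
rewrite /forecast_risk (bayes_disintegration finq.1 finq.2).
rewrite (bayes_disintegration fink.1 fink.2) -integralB//; last 2 first.
- exact: (integrable_swapped finq).
- exact: (integrable_swapped fink).
apply: ae_eq_integral => //.
- by apply: emeasurable_funB; apply: measurable_int;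
    [exact: (integrable_swapped finq)|exact: (integrable_swapped fink)].
apply: filterS2 (ae_integrable_score fink) (ae_integrable_score finq).
move=> x ik iq _; rewrite divergence_swapped integralB//; exact: integrableN.
Qed.

Lemma excess_risk_ge0 : Defs.proper S ->
  0 <= \int[prior_predictive M pi]_x divergence S (k x) (q x).
Proof.
move=> propS.
(* Properness compares expected scores; it bounds the divergence only where they
   are finite, hence almost everywhere. *)
rewrite (@ae_eq_integral _ _ _ _ _ (fun x => `|divergence S (k x) (q x)|))//.
- exact: integral_ge0.
  exact: measurableT_comp.
apply: filterS2 (ae_integrable_score fink) (ae_integrable_score finq).
by move=> x ik iq _; rewrite gee0_abs// divergence_ge0.
Qed.

End excess_risk.

(** * The decomposition *)

Theorem proposition3p3 (R : realType) (Om : ptopologicalType)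
  (polish_Om : polish R Om)
  (d : measure_display) (X : measurableType d)
  (lambda : {sigma_finite_measure set X -> \bar R})
  (M : dominated_model Om lambda)
  (Lam : set (prior R Om))
  (post : prior R Om -> X -> prior R Om)
  (postP : forall a, Lam a -> bayes_posterior M a (post a))
  (S : prior R Om -> borel Om -> \bar R)
  (score_S : scoring_rule S) (proper_S : strictly_proper S)
  (finite_entropy : forall pi, Lam pi ->
     (pi : {measure set (borel Om) -> \bar R}).-integrable setT (S pi))
  (finite_risks : forall delta pi, decision_rule Lam delta -> Lam pi ->
     finite_risk M post S delta pi) :
  forall pi : prior R Om, Lam pi ->
    min_bayes_risk M Lam post S pi = entropy S pi - information M post S pi /\
    0 <= information M post S pi.
Proof.
move=> pi Lpi.
have bk := postP _ Lpi.
have const_rule : decision_rule Lam (fun _ : X => pi).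
  by split=> //; exact: measurable_cst.
have fink : finite_forecast M pi S (post pi) :=
  finite_risks _ _ const_rule Lpi.
have [mSpi Spioo] := integrableP _ _ _ (finite_entropy _ Lpi).
have int_law t (c : \bar R) : \int[law M t]_x c = c.
  rewrite integral_cst//.
  by rewrite [X in _ * X](@probability_setT _ _ _ (law M t)) mule1.
have finpi : finite_forecast M pi S (fun=> pi).
  split.
    by apply: measurableT_comp => //; exact: measurableT_comp.
  under eq_integral do rewrite int_law abseN.
  exact: Spioo.
have riskpi : forecast_risk M pi S (fun=> pi) = entropy S pi.
  rewrite /forecast_risk; under eq_integral do rewrite int_law.
  rewrite integralN//.
  exact: (integrable_add_def measurableT (finite_entropy _ Lpi)).
have infoE : information M post S pi =
    entropy S pi - forecast_risk M pi S (post pi).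
  by rewrite -riskpi -(excess_riskE bk).
split; last by exact: (excess_risk_ge0 bk fink finpi proper_S.1).
have -> : entropy S pi - information M post S pi =
    forecast_risk M pi S (post pi).
  have finH := forecast_risk_fin finpi; have finr := forecast_risk_fin fink.
  rewrite infoE -riskpi -(fineK finH) -(fineK finr) -!EFinB.
  by rewrite subKr.
apply/eqP; rewrite eq_le; apply/andP; split.
  by apply: ereal_inf_lbound; exists (fun=> pi).
apply: le_ereal_inf_tmp => _ [delta rdelta <-].
have finq : finite_forecast M pi S (fun x => post (delta x) x) :=
  finite_risks _ _ rdelta Lpi.
rewrite -sube_ge0 ?forecast_risk_fin//.
rewrite -(excess_riskE bk fink finq).
exact: (excess_risk_ge0 bk fink finq proper_S.1).
Qed.
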